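(* Given a closed set $\Lambda\subset\mathbb{S}^n$, one has $$h_c(\Lambda)=\Delta(X)$$ for any uniformly distributed set $X$ in the convex hull $H(\Lambda)$.
   Context: Let $n\ge1$. $(\mathbb{B}^{n+1},d)$ is the unit ball model of hyperbolic space with boundary at infinity $\mathbb{S}^n$; $B_R(z)$ is the hyperbolic ball of centre $z$ and radius $R$, and $\mathrm{vol}$ is hyperbolic volume. For a closed $\Lambda\subset\mathbb{S}^n$, the convex hull $H(\Lambda)\subset\mathbb{B}^{n+1}$ is the hyperbolic convex hull of the union of all geodesics with both end points in $\Lambda$, and $H_\varepsilon(\Lambda)$ is its $\varepsilon$-neighbourhood. The convex core entropy is $$h_c(\Lambda)=\limsup_{R\to\infty}\frac{\log\mathrm{vol}(B_R(z)\cap H_\varepsilon(\Lambda))}{R};$$ here $z\in\mathbb{B}^{n+1}$ and $\varepsilon>0$ are arbitrary (the independence of $\varepsilon$ is part of what this proposition shows, so the equality is to be understood for every $\varepsilon>0$ and every $z$). If $\Lambda$ has at most one point (empty hull), $h_c(\Lambda)$ is taken to be $0$. A discrete set $X\subset H(\Lambda)$ is uniformly distributed if (i) there is $M<\infty$ such that every $z\in H(\Lambda)$ has some $x\in X$ with $d(x,z)\le M$, and (ii) there is $m>0$ with $d(x,x')\ge m$ for all distinct $x,x'\in X$. Its critical exponent is $\Delta(X)=\inf\{s>0:\sum_{x\in X}e^{-s\,d(x,z)}<\infty\}$, for any reference point $z\in\mathbb{B}^{n+1}$. *)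

(* Defs.v *)
From HB Require Import structures.
From mathcomp Require Import all_boot all_order all_algebra.
From mathcomp Require Import all_classical all_reals all_analysis.
Set Implicit Arguments.
Unset Strict Implicit.
Unset Printing Implicit Defensive.
Import Order.TTheory GRing.Theory Num.Theory.
Import numFieldNormedType.Exports.
Local Open Scope classical_set_scope.
Local Open Scope ring_scope.

(* Lebesgue measure on R^m, carried by m.-tuple R because the library has no
   measurable structure on row vectors. *)
Section lebesgue_tuple.
Context {R : realType}.
Local Notation RT := (measurableTypeR R).

Definition cons_pair m (p : m.-tuple RT * RT) : m.+1.-tuple RT :=
  [tuple of p.2 :: p.1].

Lemma measurable_cons_pair m : measurable_fun [set: _] (@cons_pair m).
Proof. exact: measurable_cons. Qed.

Section step.
Variables (m : nat) (mu : {measure set (m.-tuple RT) -> \bar R}).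

Definition lebesgue_cons : set (m.+1.-tuple RT) -> \bar R :=
  pushforward (mu \x @lebesgue_measure R)%E (@cons_pair m).

Let lebesgue_cons0 : lebesgue_cons set0 = 0%E.
Proof. by rewrite /lebesgue_cons /pushforward preimage_set0 measure0. Qed.

Let lebesgue_cons_ge0 A : (0 <= lebesgue_cons A)%E.
Proof. by rewrite /lebesgue_cons /pushforward; exact: measure_ge0. Qed.

Let lebesgue_cons_sigma_additive : semi_sigma_additive lebesgue_cons.
Proof.
have mpre A : measurable A -> measurable (@cons_pair m @^-1` A).
  by move=> mA; rewrite -[X in measurable X]setTI; exact: measurable_cons_pair.
move=> F mF tF mUF; rewrite /lebesgue_cons /pushforward preimage_bigcup.
apply: measure_semi_sigma_additive.
- by move=> i; exact: mpre.
- apply/trivIsetP => i j _ _ ij; rewrite -preimage_setI.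
  by move/trivIsetP : tF => /(_ _ _ _ _ ij) ->//; rewrite preimage_set0.
- by rewrite -preimage_bigcup; exact: mpre.
Qed.

HB.instance Definition _ := isMeasure.Build _ _ _ lebesgue_cons
  lebesgue_cons0 lebesgue_cons_ge0 lebesgue_cons_sigma_additive.

End step.

Fixpoint lebesgue_tuple m : {measure set (m.-tuple RT) -> \bar R} :=
  match m with
  | 0 => dirac [tuple]
  | m'.+1 => lebesgue_cons (lebesgue_tuple m')
  end.

End lebesgue_tuple.

Section hyperbolic_ball.
Context {R : realType} {m : nat}.
Local Notation V := 'rV[R]_m.

(* The Euclidean norm is defined by hand: the library's norm on matrices is the
   sup norm. Both norms induce the topology that the library puts on V. *)
Definition enorm (x : V) : R := Num.sqrt (\sum_(i < m) x ord0 i ^+ 2).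

Definition hspace : set V := [set x | enorm x < 1].
Definition hboundary : set V := [set x | enorm x = 1].

Definition arcosh (t : R) : R := ln (t + Num.sqrt (t ^+ 2 - 1)).

(* Distance of curvature -1, i.e. of the metric 4 |dx|^2 / (1 - |x|^2)^2. It is
   meaningful only for points of hspace. *)
Definition hdist (x y : V) : R :=
  arcosh (1 + 2 * enorm (x - y) ^+ 2
                / ((1 - enorm x ^+ 2) * (1 - enorm y ^+ 2))).

Definition hball (z : V) (r : R) : set V :=
  [set x | hspace x /\ hdist z x < r].

Definition hneighborhood (e : R) (A : set V) : set V :=
  [set x | hspace x /\ exists2 y, A y & hdist x y < e].

Definition hvol (A : set V) : \bar R :=
  (\int[lebesgue_tuple m]_(t in [set t | A (\row_i tnth t i)%R])
     ((2 / (1 - enorm (\row_i tnth t i) ^+ 2)) ^+ m)%:E)%E.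

Definition geodesic_on (I : set R) (g : R -> V) : Prop :=
  (forall t, I t -> hspace (g t)) /\
  (forall s t, I s -> I t -> hdist (g s) (g t) = `|s - t|).

Definition hconvex (C : set V) : Prop :=
  C `<=` hspace /\
  forall (a b : R) (g : R -> V), a <= b -> geodesic_on `[a, b] g ->
    C (g a) -> C (g b) -> forall t, t \in `[a, b] -> C (g t).

Definition geodesics_ending_in (L : set V) : set (R -> V) :=
  [set g | geodesic_on setT g /\
     exists2 xi, L xi & exists2 eta, L eta &
       (g t @[t --> -oo] --> xi) /\ (g t @[t --> +oo] --> eta)].

Definition convex_hull (L : set V) : set V :=
  smallest hconvex (\bigcup_(g in geodesics_ending_in L) range g).

(* By convention 0 when L has at most one point, i.e. when the hull is empty;
   otherwise the volume is eventually positive (lne 0 = -oo). *)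
Definition convex_core_entropy (L : set V) (z : V) (e : R) : \bar R :=
  if `[< is_subset1 L >] then 0%E
  else limf_esup (fun r : R =>
    (lne (hvol (hball z r `&` hneighborhood e (convex_hull L)))
       * (r^-1)%:E)%E) (pinfty_nbhs R).

Definition uniformly_distributed (L X : set V) : Prop :=
  [/\ X `<=` convex_hull L,
      X `<=` isolated X,
      (exists M : R, forall z, convex_hull L z ->
         exists2 x, X x & hdist x z <= M) &
      (exists2 d : R, 0 < d & forall x x', X x -> X x' -> x <> x' ->
         d <= hdist x x')].

Definition critical_exponent (X : set V) (z : V) : \bar R :=
  ereal_inf [set s%:E | s in [set s : R | 0 < s /\
    (\esum_(x in X) (expR (- s * hdist x z))%:E < +oo)%E]].

End hyperbolic_ball.

(* Main.v *)
Require Import Defs.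
From HB Require Import structures.
From mathcomp Require Import all_boot all_order all_algebra.
From mathcomp Require Import all_classical all_reals all_analysis.
From mathcomp Require Import measurable_realfun.
From mathcomp Require Import ring lra zify.
Set Implicit Arguments.
Unset Strict Implicit.
Unset Printing Implicit Defensive.
Import Order.TTheory GRing.Theory Num.Theory.
Import numFieldNormedType.Exports.
Local Open Scope classical_set_scope.
Local Open Scope ring_scope.


(* Points of X are spaced by a positive distance and M-dense in the hull, so
   the volume of B_R(z) within the e-neighbourhood of the hull is, up to
   constant factors and a shift of R by a constant, the number of points of X
   in B_R(z): balls of radius M + e about X cover, small balls are disjoint. The
   volume of a hyperbolic ball B_r(x) is bounded above and below uniformly in x
   because the ball is comparable to a Euclidean cube of side proportional to
   1 - |x|^2, on which the density is comparable to (1 - |x|^2)^-(n+1).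
   The exponential growth rate of the counting function is the critical
   exponent as soon as it is nonnegative, i.e. as X is nonempty; hence the
   hull must be shown to be empty exactly when L has at most one point. *)

(** * Hyperbolic functions and the inverse of cosh *)

Section cosh.
Context {R : realType}.
Implicit Types a b t : R.

Definition cosh a : R := (expR a + expR (- a)) / 2.

Definition sinh a : R := (expR a - expR (- a)) / 2.

Lemma coshN a : cosh (- a) = cosh a.
Proof. by rewrite /cosh opprK addrC. Qed.

Lemma cosh_sinh a : cosh a ^+ 2 - sinh a ^+ 2 = 1.
Proof.
rewrite /cosh /sinh expRN.
have := expR_gt0 a; set x := expR a => x0; field.
by rewrite gt_eqF.
Qed.

Lemma sinh_sqr a : sinh a ^+ 2 = cosh a ^+ 2 - 1.
Proof. by rewrite -(cosh_sinh a); ring. Qed.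

Lemma coshD a b : cosh (a + b) = cosh a * cosh b + sinh a * sinh b.
Proof.
rewrite /cosh /sinh opprD !expRD !expRN.
have := expR_gt0 a; have := expR_gt0 b.
set x := expR a; set y := expR b => y0 x0; field.
by rewrite !gt_eqF.
Qed.

Lemma sinh_ge0 a : 0 <= a -> 0 <= sinh a.
Proof. by move=> a0; rewrite /sinh divr_ge0// subr_ge0 ler_expR; lra. Qed.

Lemma cosh_ge1 a : 1 <= cosh a.
Proof.
rewrite /cosh expRN; have := expR_gt0 a; set x := expR a => x0.
rewrite -(ler_pM2l x0) -subr_ge0.
have -> : x * ((x + x^-1) / 2) - x * 1 = (x - 1) ^+ 2 / 2.
  by field; rewrite gt_eqF.
by rewrite divr_ge0// sqr_ge0.
Qed.

Lemma cosh_le_expR a : 0 <= a -> cosh a <= expR a.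
Proof.
move=> a0; rewrite /cosh ler_pdivrMr//.
have : expR (- a) <= expR a by rewrite ler_expR; lra.
lra.
Qed.

Lemma expR_le_cosh a : expR a <= 2 * cosh a.
Proof. by rewrite /cosh; have := expR_gt0 (- a); lra. Qed.

Lemma le_cosh a b : 0 <= a -> a <= b -> cosh a <= cosh b.
Proof.
move=> a0 ab; have -> : b = a + (b - a) by ring.
rewrite coshD; have := cosh_ge1 (b - a); have := cosh_ge1 a.
have : 0 <= sinh a * sinh (b - a) by rewrite mulr_ge0// sinh_ge0// subr_ge0.
nra.
Qed.

Lemma cosh_gt1 a : 0 < a -> 1 < cosh a.
Proof.
move=> a0; have : 0 < sinh a ^+ 2.
  by rewrite exprn_gt0// /sinh divr_gt0// subr_gt0 ltr_expR; lra.
have := cosh_sinh a; have := cosh_ge1 a; nra.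
Qed.

Lemma lt_cosh a b : 0 <= a -> a < b -> cosh a < cosh b.
Proof.
move=> a0 ab; have -> : b = a + (b - a) by ring.
rewrite coshD; have : 1 < cosh (b - a) by rewrite cosh_gt1// subr_gt0.
have := cosh_ge1 a.
have : 0 <= sinh a * sinh (b - a).
  by rewrite mulr_ge0// sinh_ge0// ltW// subr_gt0.
nra.
Qed.

Lemma arcosh_ge0 t : 1 <= t -> 0 <= arcosh t.
Proof.
move=> t1; rewrite /arcosh ln_ge0//; have := sqrtr_ge0 (t ^+ 2 - 1); lra.
Qed.

Lemma arcoshK t : 1 <= t -> cosh (arcosh t) = t.
Proof.
move=> t1; rewrite /cosh /arcosh expRN.
have s0 := sqrtr_ge0 (t ^+ 2 - 1).
have sE : Num.sqrt (t ^+ 2 - 1) ^+ 2 = t ^+ 2 - 1.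
  by rewrite sqr_sqrtr// subr_ge0; nra.
rewrite lnK ?posrE; last by lra.
set s := Num.sqrt _ in s0 sE *.
have -> : (t + s)^-1 = t - s.
  apply: (@mulfI _ (t + s)); first by rewrite gt_eqF//; lra.
  rewrite mulfV ?gt_eqF//; first by ring: sE.
  lra.
by field.
Qed.

Lemma le_arcosh t a : 1 <= t -> 0 <= a -> (arcosh t <= a) = (t <= cosh a).
Proof.
move=> t1 a0; apply/idP/idP => [h|h].
  by rewrite -(arcoshK t1) le_cosh// arcosh_ge0.
rewrite leNgt; apply/negP => /(lt_cosh a0).
by rewrite (arcoshK t1) ltNge h.
Qed.

Lemma cosh_inj a b : 0 <= a -> 0 <= b -> cosh a = cosh b -> a = b.
Proof.
move=> a0 b0 ab; case: (ltgtP a b) => // [/(lt_cosh a0)|/(lt_cosh b0)];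
  by rewrite ab ltxx.
Qed.

Lemma coshK a : arcosh (cosh a) = `|a|.
Proof.
apply: cosh_inj => //; first by rewrite arcosh_ge0// cosh_ge1.
rewrite arcoshK ?cosh_ge1//.
by case: (ger0P a) => // _; rewrite coshN.
Qed.

End cosh.

(** Evaluate at the minimiser [l = - b / c]. If [c = 0] the form is affine in [l], and a nonzero [b]
    would let it take the value -1. *)
Lemma discriminant_le (R : realFieldType) (a b c : R) : 0 <= c ->
  (forall l, 0 <= a + 2 * l * b + l ^+ 2 * c) -> b ^+ 2 <= a * c.
Proof.
rewrite le_eqVlt => /predU1P[<-|c0] h.
  have [->|b0] := eqVneq b 0; first by rewrite expr0n mulr0.
  have := h (- (a + 1) / (2 * b)); rewrite mulr0 addr0.
  have -> : 2 * (- (a + 1) / (2 * b)) * b = - (a + 1) by field.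
  lra.
have := h (- b / c).
have -> : a + 2 * (- b / c) * b + (- b / c) ^+ 2 * c = (a * c - b ^+ 2) / c.
  by field; rewrite gt_eqF.
by rewrite pmulr_lge0 ?invr_gt0// subr_ge0.
Qed.

(** * Euclidean inner product and Minkowski form *)

Section dot.
Context {R : realType} {m : nat}.
Local Notation V := 'rV[R]_m.
Implicit Types (x y z u v w : V) (a p q r : R).

Definition dot x y : R := \sum_(i < m) x ord0 i * y ord0 i.

Lemma dotC x y : dot x y = dot y x.
Proof. by apply: eq_bigr => i _; rewrite mulrC. Qed.

Lemma dotDl x y z : dot (x + y) z = dot x z + dot y z.
Proof.
by rewrite /dot -big_split; apply: eq_bigr => i _; rewrite mxE mulrDl.
Qed.

Lemma dotZl a x y : dot (a *: x) y = a * dot x y.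
Proof.
by rewrite /dot mulr_sumr; apply: eq_bigr => i _; rewrite mxE mulrA.
Qed.

Lemma dotDr x y z : dot x (y + z) = dot x y + dot x z.
Proof. by rewrite dotC dotDl !(dotC x). Qed.

Lemma dotZr a x y : dot x (a *: y) = a * dot x y.
Proof. by rewrite dotC dotZl dotC. Qed.

Lemma dotNl x y : dot (- x) y = - dot x y.
Proof. by rewrite -scaleN1r dotZl mulN1r. Qed.

Lemma dotNr x y : dot x (- y) = - dot x y.
Proof. by rewrite dotC dotNl dotC. Qed.

Lemma dot_ge0 x : 0 <= dot x x.
Proof. by apply: sumr_ge0 => i _; rewrite -expr2 sqr_ge0. Qed.

Lemma dot_eq0 x : dot x x = 0 -> x = 0.
Proof.
move=> /eqP; rewrite psumr_eq0 => [/allP h|i _]; last by rewrite -expr2 sqr_ge0.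
apply/rowP => i; rewrite mxE; apply/eqP.
by have := h i; rewrite mem_index_enum => /(_ isT); rewrite -expr2 sqrf_eq0.
Qed.

Definition dotE := (dotDl, dotDr, dotNl, dotNr, dotZl, dotZr).

Lemma cauchy_schwarz_dot x y : dot x y ^+ 2 <= dot x x * dot y y.
Proof.
apply: discriminant_le => [|l]; first exact: dot_ge0.
have := dot_ge0 (x + l *: y); rewrite !dotE (dotC y x); nra.
Qed.

Lemma sqr_coord_le_dot x i : x ord0 i ^+ 2 <= dot x x.
Proof.
rewrite /dot (bigD1 i)//= -expr2 lerDl sumr_ge0// => j _.
by rewrite -expr2 sqr_ge0.
Qed.

Lemma enorm_sqr x : enorm x ^+ 2 = dot x x.
Proof.
rewrite /enorm sqr_sqrtr; first by apply: eq_bigr => i _; rewrite expr2.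
by apply: sumr_ge0 => i _; rewrite sqr_ge0.
Qed.

Lemma hspaceE x : hspace x = (dot x x < 1) :> Prop.
Proof.
rewrite /hspace /mkset -enorm_sqr.
by rewrite expr_lt1// sqrtr_ge0.
Qed.

Lemma hboundaryE x : hboundary x = (dot x x = 1) :> Prop.
Proof.
rewrite /hboundary /mkset -enorm_sqr.
have : 0 <= enorm x by rewrite sqrtr_ge0.
move=> x0; apply/propext; split => [->|/eqP]; first by rewrite expr1n.
by rewrite sqrp_eq1// => /eqP.
Qed.

(* The pairs (p, u) stand for vectors of Minkowski space, with form
   p ^+ 2 - dot u u; a vector orthogonal to a unit timelike one is spacelike. *)
Lemma minkowski_spacelike p u q v : q ^+ 2 - dot v v = 1 ->
  p * q = dot u v -> p ^+ 2 <= dot u u.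
Proof.
move=> qv pq; have := cauchy_schwarz_dot u v; rewrite -pq exprMn => h.
have := dot_ge0 u; have := dot_ge0 v; nra.
Qed.

(** Subtracting from the first and third vectors their components along the second, [A] and [B]
    times it, leaves two vectors orthogonal to a timelike one. The form is semidefinite on their
    span, so the Cauchy-Schwarz inequality holds there. *)
Lemma minkowski_gram p u q v r w : p ^+ 2 - dot u u = 1 ->
  q ^+ 2 - dot v v = 1 -> r ^+ 2 - dot w w = 1 ->
  forall A B, A = p * q - dot u v -> B = q * r - dot v w ->
  (p * r - dot u w - A * B) ^+ 2 <= (A ^+ 2 - 1) * (B ^+ 2 - 1).
Proof.
move=> pu qv rw A B EA EB; rewrite -sqrrN.
have spacelike l : 0 <= dot (u - A *: v + l *: (w - B *: v))
                            (u - A *: v + l *: (w - B *: v)) -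
    (p - A * q + l * (r - B * q)) ^+ 2.
  rewrite subr_ge0; apply: (minkowski_spacelike qv).
  rewrite !dotE (dotC w v).
  have -> : dot v v = q ^+ 2 - 1 by lra.
  by rewrite EA EB; ring.
have eqB : B ^+ 2 - 1 = dot (w - B *: v) (w - B *: v) - (r - B * q) ^+ 2.
  rewrite !dotE (dotC w v).
  have -> : dot v v = q ^+ 2 - 1 by lra.
  have -> : dot w w = r ^+ 2 - 1 by lra.
  by rewrite EB; ring.
apply: discriminant_le => [|l].
  rewrite eqB subr_ge0; apply: (minkowski_spacelike qv).
  rewrite !dotE (dotC w v).
  have -> : dot v v = q ^+ 2 - 1 by lra.
  by rewrite EB; ring.
have := spacelike l; rewrite !dotE (dotC w v) (dotC w u) (dotC v u).
have -> : dot v v = q ^+ 2 - 1 by lra.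
have -> : dot w w = r ^+ 2 - 1 by lra.
have -> : dot u u = p ^+ 2 - 1 by lra.
set e1 := (X in 0 <= X -> _); set e2 := (X in _ -> 0 <= X).
suff -> : e1 = e2 by [].
by rewrite /e1 /e2 EA EB; ring.
Qed.

End dot.

(** * The hyperbolic distance and its triangle inequality *)

Section hyperbolic_metric.
Context {R : realType} {m : nat}.
Local Notation V := 'rV[R]_m.
Implicit Types (x y z : V) (a b : R).

(** The conformal factor of the ball metric is 2 / [gap], so [gap x] is, up to constants, the
    Euclidean size of a hyperbolic ball of fixed radius about [x]. *)
Definition gap x : R := 1 - dot x x.

Lemma gap_gt0 x : hspace x -> 0 < gap x.
Proof. by rewrite hspaceE /gap subr_gt0. Qed.

Lemma gap_le1 x : gap x <= 1.
Proof. by rewrite /gap gerBl dot_ge0. Qed.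

Definition cosh_dist x y : R :=
  1 + 2 * dot (x - y) (x - y) / (gap x * gap y).

Lemma hdistE x y : hdist x y = arcosh (cosh_dist x y).
Proof. by rewrite /hdist !enorm_sqr. Qed.

Lemma cosh_dist_ge1 x y : hspace x -> hspace y -> 1 <= cosh_dist x y.
Proof.
move=> /gap_gt0 x0 /gap_gt0 y0.
by rewrite lerDl divr_ge0 ?mulr_ge0 ?dot_ge0// ltW.
Qed.

Lemma cosh_hdist x y : hspace x -> hspace y -> cosh (hdist x y) = cosh_dist x y.
Proof. by move=> hx hy; rewrite hdistE arcoshK ?cosh_dist_ge1. Qed.

Lemma hdist_ge0 x y : hspace x -> hspace y -> 0 <= hdist x y.
Proof. by move=> hx hy; rewrite hdistE arcosh_ge0 ?cosh_dist_ge1. Qed.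

Lemma hdistC x y : hdist x y = hdist y x.
Proof.
by rewrite !hdistE /cosh_dist (mulrC (gap y)) -(opprB x y) dotNl dotNr opprK.
Qed.

Lemma hdist_le x y a : hspace x -> hspace y -> 0 <= a ->
  (hdist x y <= a) = (cosh_dist x y <= cosh a).
Proof. by move=> hx hy a0; rewrite hdistE le_arcosh ?cosh_dist_ge1. Qed.

(** Passage to the hyperboloid model: [x] corresponds to the vector ((1 + |x|^2) / gap x, 2 x / gap
    x), of unit length by [minkowski_unit], and cosh of the distance is the Minkowski product. *)
Lemma cosh_dist_minkowski x y : hspace x -> hspace y -> cosh_dist x y =
  (1 + dot x x) / gap x * ((1 + dot y y) / gap y)
    - dot ((2 / gap x) *: x) ((2 / gap y) *: y).
Proof.
move=> /gap_gt0 x0 /gap_gt0 y0; rewrite /cosh_dist !dotE (dotC y x).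
move: x0 y0; rewrite /gap => x0 y0; field.
by rewrite !gt_eqF.
Qed.

Lemma minkowski_unit x : hspace x -> ((1 + dot x x) / gap x) ^+ 2
  - dot ((2 / gap x) *: x) ((2 / gap x) *: x) = 1.
Proof.
move=> /gap_gt0; rewrite /gap => x0; rewrite !dotE; field.
by rewrite gt_eqF.
Qed.

(** With a, b the two distances on the right, [minkowski_gram] bounds cosh (hdist x z) - cosh a cosh
    b in absolute value by sinh a sinh b; the addition formula for cosh concludes. *)
Lemma hdist_triangle x y z : hspace x -> hspace y -> hspace z ->
  hdist x z <= hdist x y + hdist y z.
Proof.
move=> hx hy hz; rewrite hdist_le ?addr_ge0 ?hdist_ge0// coshD.
have := minkowski_gram (minkowski_unit hx) (minkowski_unit hy)
  (minkowski_unit hz) erefl erefl.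
rewrite -!cosh_dist_minkowski// -!cosh_hdist// -!sinh_sqr -exprMn.
have sab : 0 <= sinh (hdist x y) * sinh (hdist y z).
  by rewrite mulr_ge0// sinh_ge0// hdist_ge0.
rewrite -lerBlDl; set d := (_ - _); set s := (_ * _) in sab *.
by case: (lerP d s) => //; nra.
Qed.

End hyperbolic_metric.

(** * Comparison of hyperbolic balls with Euclidean cubes *)

Section balls_and_cubes.
Context {R : realType} {m : nat}.
Local Notation V := 'rV[R]_m.
Implicit Types (x y z : V) (a b r : R).

Lemma sqr_dist_le x y r : hspace x -> hspace y -> 0 <= r -> hdist x y <= r ->
  2 * dot (x - y) (x - y) <= (cosh r - 1) * (gap x * gap y).
Proof.
move=> hx hy r0; rewrite hdist_le// /cosh_dist -lerBrDl ler_pdivrMr//.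
by rewrite mulr_gt0 ?gap_gt0.
Qed.

(** The difference of gaps is the inner product of y - x and x + y, and |x + y|^2 <= 4 by the
    parallelogram law. *)
Lemma sqr_gapB_le x y : hspace x -> hspace y ->
  (gap x - gap y) ^+ 2 <= 4 * dot (x - y) (x - y).
Proof.
rewrite !hspaceE => hx hy.
have -> : gap x - gap y = - dot (x - y) (x + y).
  by rewrite /gap !dotE (dotC y x); ring.
rewrite sqrrN (le_trans (cauchy_schwarz_dot _ _))// mulrC ler_wpM2r ?dot_ge0//.
have := dot_ge0 (x - y); rewrite !dotE (dotC y x); lra.
Qed.

(** For the two gaps u and v, the previous bounds give (u - v)^2 <= 2 (cosh r - 1) u v, hence u^2 <=
    2 cosh r u v. *)
Lemma gap_le x y r : hspace x -> hspace y -> 0 <= r -> hdist x y <= r ->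
  gap x <= 2 * cosh r * gap y.
Proof.
move=> hx hy r0 xy; have := sqr_dist_le hx hy r0 xy.
have := sqr_gapB_le hx hy; have := gap_gt0 hx; have := gap_gt0 hy.
set d := dot _ _; set u := gap x; set v := gap y; set k := cosh r.
move=> v0 u0 h1 h2.
have h : (u - v) ^+ 2 <= 2 * (k - 1) * (u * v) by lra.
rewrite -(ler_pM2l u0); nra.
Qed.

Lemma coord_le x y r i : hspace x -> hspace y -> 0 <= r -> hdist x y <= r ->
  `|y ord0 i - x ord0 i| <= cosh r * gap x.
Proof.
move=> hx hy r0 xy.
have k1 := cosh_ge1 r.
rewrite -(@ler_pXn2r _ 2)// ?nnegrE ?mulr_ge0 ?(le_trans _ k1)//; last first.
  by rewrite ltW ?gap_gt0.
rewrite real_normK ?num_real//.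
have -> : y ord0 i - x ord0 i = (y - x) ord0 i by rewrite !mxE.
apply: (le_trans (sqr_coord_le_dot _ _)).
have -> : dot (y - x) (y - x) = dot (x - y) (x - y).
  by rewrite -(opprB x y) dotNl dotNr opprK.
have := sqr_dist_le hx hy r0 xy.
rewrite hdistC in xy; have := gap_le hy hx r0 xy.
have := gap_gt0 hx; have := gap_gt0 hy.
set d := dot _ _; set u := gap x; set v := gap y; set k := cosh r in k1 *.
move=> v0 u0 vu h.
have : (k - 1) * u * v <= (k - 1) * u * (2 * k * u).
  apply: ler_wpM2l vu; apply: mulr_ge0 (ltW u0); lra.
have : 0 <= k * u ^+ 2 by rewrite mulr_ge0 ?sqr_ge0//; lra.
nra.
Qed.

(** Expand [gap y] around [x]: the linear term is at most half of [gap x], and the quadratic one at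
    most a sixteenth because [gap x <= 1]. *)
Lemma gap_near x y c : hspace x -> 0 <= c -> c <= 1 / 4 ->
  dot (y - x) (y - x) <= (c * gap x) ^+ 2 ->
  gap x / 4 <= gap y /\ gap y <= 2 * gap x.
Proof.
move=> hx c0 c4 h.
have u0 := gap_gt0 hx; have u1 := gap_le1 x.
have E : gap y = gap x - 2 * dot x (y - x) - dot (y - x) (y - x).
  by rewrite /gap !dotE (dotC y x); ring.
have d0 := dot_ge0 (y - x).
have /ler_normlP[] : `|dot x (y - x)| <= c * gap x.
  rewrite -(@ler_pXn2r _ 2)// ?nnegrE ?mulr_ge0 ?(ltW u0)//.
  rewrite real_normK ?num_real//.
  apply: (le_trans (cauchy_schwarz_dot _ _)); apply: le_trans h.
  by rewrite ler_piMl// ltW// -hspaceE.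
rewrite E; set p := dot x _; set d := dot _ _ in d0 h *.
set u := gap x in u0 u1 h *.
move=> p1 p2.
have : c * u <= u / 4 by nra.
have : (c * u) ^+ 2 <= u / 16.
  have : c * u <= u / 4 by nra.
  have : 0 <= c * u by rewrite mulr_ge0// ltW.
  nra.
split; lra.
Qed.

Lemma cube_sub_hball d : 0 < d -> exists2 c : R, 0 < c & forall x y,
  hspace x -> (forall i, `|y ord0 i - x ord0 i| <= c * gap x) ->
  [/\ hspace y, gap y <= 2 * gap x & hdist x y <= d].
Proof.
(* The first bound is for [gap_near]. Together they give c^2 <= (cosh d - 1) / 8, which suffices for
   the distance since gap y >= gap x / 4. *)
move=> d0; pose c : R := Num.min (1 / 4) ((cosh d - 1) / 2).
have k1 : 0 < (cosh d - 1) / 2 by rewrite divr_gt0// subr_gt0 cosh_gt1.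
have c0 : 0 < c by rewrite /c lt_min k1 andbT.
have [c4 ck] : c <= 1 / 4 /\ c <= (cosh d - 1) / 2.
  by split; rewrite /c ge_min lexx ?orbT.
have m0 : (0 : R) < m.+1%:R by rewrite ltr0n.
(* The sum of m squared coordinates stays below (c gap x)^2; dividing by m + 1 also covers m = 0. *)
exists (c / m.+1%:R) => [|x y hx xy]; first by rewrite divr_gt0.
have u0 := gap_gt0 hx.
have h : dot (y - x) (y - x) <= (c * gap x) ^+ 2.
  apply: (@le_trans _ _ (\sum_(i < m) (c / m.+1%:R * gap x) ^+ 2)).
    apply: ler_sum => i _; rewrite -expr2 !mxE -[leLHS]real_normK ?num_real//.
    by rewrite ler_pXn2r ?nnegrE// ?mulr_ge0// ltW// divr_gt0.
  rewrite sumr_const card_ord -[leLHS]mulr_natr.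
  have -> : (c / m.+1%:R * gap x) ^+ 2 * m%:R =
      (c * gap x) ^+ 2 * (m%:R / m.+1%:R ^+ 2).
    by field; rewrite gt_eqF// [X in _ < X](_ : _ = m.+1%:R)// -natr1 addrC.
  rewrite ler_piMr ?sqr_ge0// ler_pdivrMr ?exprn_gt0// mul1r.
  by rewrite -natrX ler_nat; lia.
have [g1 g2] := gap_near hx (ltW c0) c4 h.
have hy : hspace y.
  by rewrite hspaceE -subr_gt0 -/(gap y) (lt_le_trans _ g1)// divr_gt0.
split => //; rewrite hdist_le// ?(ltW d0)// /cosh_dist -lerBrDl.
rewrite ler_pdivrMr ?mulr_gt0 ?gap_gt0//.
have -> : dot (x - y) (x - y) = dot (y - x) (y - x).
  by rewrite -(opprB y x) dotNl dotNr opprK.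
set D := dot _ _ in h *; set u := gap x in u0 g1 g2 h *.
set v := gap y in g1 g2 *.
have h1 : c ^+ 2 <= (cosh d - 1) / 8 by nra.
have h2 : (cosh d - 1) / 4 * u ^+ 2 <= (cosh d - 1) * (u * v).
  have : (cosh d - 1) * u * (u / 4) <= (cosh d - 1) * u * v.
    apply: ler_wpM2l g1; apply: mulr_ge0 (ltW u0); lra.
  lra.
have : c ^+ 2 * u ^+ 2 <= (cosh d - 1) / 8 * u ^+ 2.
  by rewrite ler_wpM2r// sqr_ge0.
rewrite exprMn in h; lra.
Qed.

End balls_and_cubes.

(* Unlike [ge0_le_integral], this applies to nonmeasurable functions. *)
Lemma ge0_le_integral_sup d (T : measurableType d) (R : realType)
    (mu : {measure set T -> \bar R}) (f g : T -> \bar R) :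
  (forall x, 0 <= f x)%E -> (forall x, f x <= g x)%E ->
  (\int[mu]_x f x <= \int[mu]_x g x)%E.
Proof.
move=> f0 fg; rewrite !ge0_integralE//; last first.
  by move=> x _; exact: le_trans (fg x).
apply: ereal_sup_le => _ [h hf <-]; exists h => // x.
by apply: le_trans (hf x) _; rewrite !patch_setT.
Qed.

(** * Lebesgue measure of cubes *)

Section lebesgue_cube.
Context {R : realType}.
Local Notation RT := (measurableTypeR R).

Definition cube m (a : 'I_m -> R) (r : R) : set (m.-tuple RT) :=
  [set t | forall i, `|tnth t i - a i| <= r].

Lemma norm_le_itv (a r : R) :
  [set s : R | `|s - a| <= r] = [set` `[a - r, a + r]].
Proof.
apply/seteqP; split => s /=; rewrite in_itv/=.
  by rewrite ler_distl.
by rewrite ler_distl.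
Qed.

Lemma measurable_cube m a r : measurable (@cube m a r).
Proof.
have -> : cube a r = \bigcap_(i in [set: 'I_m])
    ((fun t : m.-tuple RT => tnth t i) @^-1` [set s | `|s - a i| <= r]).
  by apply/seteqP; split => [t h i _|t h i]; exact: h.
apply: fin_bigcap_measurable => [|i _]; first exact: finite_finset.
rewrite -[X in measurable X]setTI; apply: measurable_tnth => //.
by rewrite norm_le_itv; exact: measurable_itv.
Qed.

Lemma lebesgue_tuple_cube m (a : 'I_m -> R) (r : R) : 0 <= r ->
  lebesgue_tuple m (cube a r) = ((2 * r) ^+ m)%:E.
Proof.
move=> r0; elim: m a => [|m IH] a.
  rewrite /= diracE mem_set ?expr0// => i; by case: i.
rewrite /= /lebesgue_cons /pushforward.
have -> : @cons_pair R m @^-1` cube a r =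
    cube (fun i => a (lift ord0 i)) r `*` [set s | `|s - a ord0| <= r].
  apply/seteqP; split => [[p s] /= h|[p s] /= [h1 h2] i].
    by split => [i|]; [have := h (lift ord0 i)|have := h ord0];
      rewrite !(tnth_nth 0).
  by case: (unliftP ord0 i) => [j ->|->]; [have := h1 j|move: h2];
    rewrite !(tnth_nth 0).
rewrite norm_le_itv product_measure1E//; last first.
- exact: measurable_cube.
rewrite IH [X in (_ * X)%E](lebesgue_measure_itv `[_, _])/= lte_fin ltrD2l.
case: ltP => h; first by rewrite -EFinD -EFinM exprSr; congr (_ * _)%:E; ring.
(* Degenerate cube: the exponent is a successor, so both sides vanish. *)
have -> : r = 0 by lra.
by rewrite !mule0 mulr0 exprS mul0r.
Qed.

End lebesgue_cube.

(** * Volume bounds from coverings and packings *)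

Section volume_counting.
Context {R : realType} {m : nat}.
Local Notation V := 'rV[R]_m.
Local Notation RT := (measurableTypeR R).
Implicit Types (x y z : V) (s : seq V) (A : set V) (t : m.-tuple RT).

Let row t : V := \row_i tnth t i.

(** A step function to be compared with the hyperbolic density. Each of its terms with centre in the
    ball has the same integral, since [gap x] cancels between height and side. The absolute value
    keeps it nonnegative for centres outside the ball too. *)
Definition cubes_density s (rho k : R) t : \bar R :=
  (\sum_(x <- s)
     (`|k / gap x| ^+ m * \1_(cube (x ord0) (rho * gap x)) t)%:E)%E.

Lemma cubes_density_ge0 s rho k t : (0 <= cubes_density s rho k t)%E.
Proof.
by apply: sume_ge0 => x _; rewrite lee_fin mulr_ge0// exprn_ge0.
Qed.

Lemma integral_cubes_density s (rho k : R) : 0 <= rho -> 0 <= k ->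
  (forall x, x \in s -> hspace x) ->
  (\int[lebesgue_tuple m]_t cubes_density s rho k t =
   ((size s)%:R * (2 * rho * k) ^+ m)%:E)%E.
Proof.
move=> rho0 k0 hs.
have mcube x : measurable (cube (x ord0) (rho * gap x) : set (m.-tuple RT)).
  exact: measurable_cube.
pose f x t : \bar R := (`|k / gap x| ^+ m *
  \1_(cube (x ord0) (rho * gap x)) t)%:E.
have mind x : measurable_fun setT (f x).
  by apply/measurable_EFinP/measurable_funM.
have ind0 x t : setT t -> (0 <= f x t)%E.
  by rewrite lee_fin mulr_ge0// exprn_ge0.
rewrite [LHS](ge0_integral_sum (lebesgue_tuple m) measurableT mind ind0).
rewrite (@eq_big_seq _ _ _ _ s _ (fun=> ((2 * rho * k) ^+ m)%:E)); last first.
  move=> x /hs /gap_gt0 u0.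
  rewrite (@integralZl_indic _ _ _ _ _ measurableT
    (fun=> cube (x ord0) (rho * gap x)))//; last first.
    by rewrite ltNge exprn_ge0.
  rewrite integral_indic// setIT lebesgue_tuple_cube ?mulr_ge0 ?(ltW u0)//.
  rewrite -EFinM -exprMn ger0_norm ?divr_ge0 ?(ltW u0)//; congr (_ ^+ _)%:E.
  by field; rewrite gt_eqF.
rewrite sumEFin big_const_seq count_predT iter_addr addr0.
rewrite -[X in X%:E = _]mulr_natl.
reflexivity.
Qed.

Lemma hvol_restrict A : hvol A = (\int[lebesgue_tuple m]_t
  ((fun t => ((2 / gap (row t)) ^+ m)%:E) \_ [set t | A (row t)]) t)%E.
Proof.
rewrite /hvol integral_mkcond; apply: eq_integral => t _.
by rewrite /patch /gap -enorm_sqr.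
Qed.

(** Pointwise domination: a point of [A] within [r] of [x] lies in the cube of half-side cosh r gap
    x by [coord_le], and by [gap_le] the density there is at most (4 cosh r / gap x)^m. *)
Lemma hvol_le_covering s A (r : R) : 0 <= r -> A `<=` hspace ->
  (forall x, x \in s -> hspace x) ->
  (forall y, A y -> exists2 x, x \in s & hdist x y <= r) ->
  (hvol A <= ((size s)%:R * (2 * cosh r * (4 * cosh r)) ^+ m)%:E)%E.
Proof.
move=> r0 hA hs cov; have k1 := cosh_ge1 r.
have k0 : 0 <= cosh r by lra.
rewrite -integral_cubes_density ?mulr_ge0// hvol_restrict.
apply: ge0_le_integral_sup => t; rewrite /patch.
  case: ifPn => // /set_mem /= /hA /gap_gt0 u0.
  by rewrite lee_fin exprn_ge0// divr_ge0// ltW.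
case: ifPn => [/set_mem /= At|_]; last exact: cubes_density_ge0.
have [x xs xy] := cov _ At; have hx := hs _ xs; have hy := hA _ At.
rewrite /cubes_density (big_rem x)//= -[leLHS]adde0 leeD//; last first.
  by apply: sume_ge0 => x' _; rewrite lee_fin mulr_ge0// exprn_ge0.
rewrite lee_fin indicE mem_set ?mulr1; last first.
  move=> i; have := coord_le i hx hy r0 xy; by rewrite mxE.
rewrite ger0_norm ?divr_ge0 ?mulr_ge0 ?(ltW (gap_gt0 hx))//.
have [u0 v0] := (gap_gt0 hx, gap_gt0 hy).
apply: lerXn2r; rewrite ?nnegrE ?divr_ge0 ?mulr_ge0 ?(ltW u0) ?(ltW v0)//.
rewrite ler_pdivrMr// mulrAC ler_pdivlMr//.
have := gap_le hx hy r0 xy; lra.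
Qed.

(** The cubes given by [cube_sub_hball] lie in balls of radius [d] about points more than [2 * d]
    apart. Hence at most one term of [cubes_density] is nonzero at each point, and it is below the
    density since gap y <= 2 gap x on the cube. *)
Lemma hvol_ge_packing (d : R) : 0 < d -> exists2 c : R, 0 < c &
  forall s A, uniq s -> (forall x, x \in s -> hspace x) -> A `<=` hspace ->
    (forall x y, x \in s -> y \in s -> x != y -> 2 * d < hdist x y) ->
    (forall x y, x \in s -> hspace y -> hdist x y <= d -> A y) ->
  (((size s)%:R * c)%:E <= hvol A)%E.
Proof.
move=> /(@cube_sub_hball R m) [rho rho0 hrho].
exists ((2 * rho * 1) ^+ m) => [|s A us hs hA sep sub].
  by rewrite exprn_gt0// mulr1 mulr_gt0.
rewrite -integral_cubes_density//; last exact: ltW.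
rewrite hvol_restrict.
apply: ge0_le_integral_sup => t; first exact: cubes_density_ge0.
have in_cube x : x \in s ->
    t \in (cube (x ord0) (rho * gap x) : set (_.-tuple RT)) ->
    [/\ hspace (row t), gap (row t) <= 2 * gap x & hdist x (row t) <= d].
  move=> /hs hx /set_mem tx; apply: hrho hx _ => i.
  by rewrite mxE; exact: tx.
have [[x xs tx]|none] := pselect (exists2 x, x \in s &
    t \in (cube (x ord0) (rho * gap x) : set (_.-tuple RT))); last first.
  rewrite /cubes_density big_seq big1 => [|x xs].
    rewrite /patch; case: ifPn => // /set_mem /= /hA /gap_gt0 u0.
    by rewrite lee_fin exprn_ge0// divr_ge0// ltW.
  rewrite indicE; case: (boolP (t \in _)) => [tx|_]; last by rewrite mulr0.
  by exfalso; apply: none; exists x.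
have [ht gt dt] := in_cube _ xs tx; have hx := hs _ xs.
have At : A (row t) by exact: (sub _ _ xs).
rewrite /cubes_density (bigD1_seq x)//= big_seq_cond big1 => [|y /andP[ys yx]].
  rewrite adde0 indicE tx mulr1 /patch mem_set// lee_fin.
  have [u0 v0] := (gap_gt0 hx, gap_gt0 ht).
  rewrite ger0_norm ?divr_ge0 ?(ltW u0)//.
  apply: lerXn2r; rewrite ?nnegrE ?divr_ge0 ?(ltW u0) ?(ltW v0)//.
  by rewrite ler_pdivrMr// mulrAC ler_pdivlMr// mul1r.
rewrite indicE; case: (boolP (t \in _)) => [ty|_]; last by rewrite mulr0.
exfalso; have [_ _ dty] := in_cube _ ys ty.
have := sep _ _ ys xs yx; have := hdist_triangle (hs _ ys) ht hx.
rewrite (hdistC (row t)); lra.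
Qed.

End volume_counting.

(** * Geodesics with prescribed ends and emptiness of the hull *)

Section convex_hull.
Context {R : realType} {m : nat}.
Local Notation V := 'rV[R]_m.
Implicit Types (x y xi eta : V) (L : set V) (g : R -> V).

Lemma cvg_dotB g1 g2 (F : set_system R) {FF : Filter F} xi :
  g1 t @[t --> F] --> xi -> g2 t @[t --> F] --> xi ->
  dot (g1 t - g2 t) (g1 t - g2 t) @[t --> F] --> (0 : R).
Proof.
move=> h1 h2.
have h i : (g1 t - g2 t) ord0 i @[t --> F] --> (0 : R).
  have -> : (0 : R) = (xi - xi) ord0 i by rewrite subrr mxE.
  apply: (@continuous_cvg _ _ _ _ _ (fun t => g1 t - g2 t)
    (fun M : V => M ord0 i)); first exact: coord_continuous.
  exact: cvgB h1 h2.
have -> : (0 : R) = \sum_(i < m) (0 * 0).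
  by rewrite big1// => i _; rewrite mulr0.
apply: cvg_big => [|i _].
  by move=> [a b]; apply: add_continuous.
exact: cvgM (h i) (h i).
Qed.

Lemma hconvex_hspace : hconvex (@hspace R m).
Proof. by split=> // a b g _ [hg _] _ _ t tab; apply: hg. Qed.

Lemma convex_hull_sub_hspace L : convex_hull L `<=` hspace.
Proof.
apply: smallest_sub; first exact: hconvex_hspace.
by move=> x [g [[hg _] _] [t _ <-]]; exact: hg.
Qed.

(** Since cosh (hdist 0 y) = 2 / gap y - 1 >= 1 / gap y, the triangle inequality through [x] gives
    the bound. *)
Lemma inv_gap_le x y : hspace x -> hspace y ->
  (gap y)^-1 <= expR (hdist x y) * expR (hdist 0 x).
Proof.
have h0 : hspace (0 : V) by rewrite hspaceE -(scale0r 0) dotZl mul0r.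
move=> hx hy; rewrite -expRD addrC.
apply: le_trans (_ : cosh (hdist 0 y) <= _); last first.
  rewrite (le_trans (cosh_le_expR (hdist_ge0 h0 hy)))// ler_expR.
  exact: hdist_triangle.
have u0 := gap_gt0 hy; have u1 := gap_le1 y.
rewrite cosh_hdist// /cosh_dist sub0r dotNl dotNr opprK.
have -> : gap (0 : V) = 1 by rewrite /gap -(scale0r 0) dotZl mul0r subr0.
have -> : dot y y = 1 - gap y by rewrite /gap; ring.
rewrite mul1r; have uv : gap y * (gap y)^-1 = 1 by rewrite mulfV// gt_eqF.
have v1 : 1 <= (gap y)^-1 by rewrite invf_ge1.
set v := _^-1 in uv v1 *; lra.
Qed.

(** Let D be the squared Euclidean distance of g t and g (- t). Then cosh (2 t) = 1 + 2 D / (gap (g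
    t) gap (g (- t))), and each inverse gap is at most C e^t, so D cannot tend to 0. *)
Lemma geodesic_ends_distinct g xi : geodesic_on setT g ->
  g t @[t --> -oo] --> xi -> g t @[t --> +oo] --> xi -> False.
Proof.
move=> [hg dg] /cvgNy_compNP gN gP.
pose C := expR (hdist 0 (g 0)); have C0 : 0 < C := expR_gt0 _.
(* If D is below this, e^(2t) <= 2 + 4 C^2 D e^(2t) forces e^(2t) <= 8/3, whereas t >= 1 gives
   e^(2t) >= 3. *)
have C2 : 0 < 1 / (16 * C ^+ 2) by rewrite divr_gt0// mulr_gt0// exprn_gt0.
have near0 := iffLR (cvgrPdist_lt _ _) (cvg_dotB gP gN).
have near1 : \forall t \near +oo,
    `|0 - dot (g t - (g \o -%R) t) (g t - (g \o -%R) t)| < 1 / (16 * C ^+ 2).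
  exact: near0 C2.
have near2 := @nbhs_pinfty_ge R 1 (num_real _).
have [t /= [t1]] := filter_ex (filterI near2 near1).
rewrite sub0r normrN ger0_norm ?dot_ge0//.
have dE : hdist (g t) (g (- t)) = 2 * t.
  by rewrite dg// opprK ger0_norm; [ring|lra].
have ht := hg t I; have hNt := hg (- t) I.
have := inv_gap_le (hg 0 I) ht; have := inv_gap_le (hg 0 I) hNt.
rewrite !dg// !sub0r opprK normrN ger0_norm; last by lra.
rewrite -/C; have := cosh_hdist ht hNt; rewrite dE /cosh_dist.
have := expR_le_cosh (2 * t); have := expR_ge1Dx (2 * t).
have -> : expR (2 * t) = expR t ^+ 2 by rewrite expRM_natl.
set E := expR t; have E0 : 0 < E := expR_gt0 _.
set D := dot _ _.
have u0 := gap_gt0 ht; have v0 := gap_gt0 hNt; rewrite invfM.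
have D0 : 0 <= D := dot_ge0 _.
have uI : 0 <= (gap (g t))^-1 by rewrite invr_ge0 ltW.
have vI : 0 <= (gap (g (- t)))^-1 by rewrite invr_ge0 ltW.
set u := (gap (g t))^-1 in uI *; set v := (gap (g (- t)))^-1 in vI *.
move=> E2 ch chE; rewrite chE in ch => v1 u1.
rewrite ltr_pdivlMr ?mulr_gt0 ?exprn_gt0// => DC.
have uv : u * v <= E ^+ 2 * C ^+ 2 by rewrite -exprMn expr2 ler_pM.
have : D * (u * v) <= D * (E ^+ 2 * C ^+ 2) by rewrite ler_wpM2l.
nra.
Qed.

(** No geodesic has both ends in [L], and the empty set is convex. *)
Lemma convex_hull_subset1 L : is_subset1 L -> convex_hull L = set0.
Proof.
move=> L1; apply/seteqP; split => //; apply: smallest_sub => //.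
  by split => // a b g _ _ [].
move=> x [g [gg [xi Lxi [eta Leta [gN gP]]]] _].
rewrite (L1 _ _ Leta Lxi) in gP.
exact: geodesic_ends_distinct gg gN gP.
Qed.

Lemma cvg_boundary_geodesic (q : R) xi eta :
  (q + expR t + expR (- t))^-1 *: (expR t *: xi + expR (- t) *: eta)
    @[t --> +oo] --> xi.
Proof.
have e0 : expR (- t) @[t --> +oo] --> (0 : R) by exact: cvgr_expR.
(* Multiply numerator and denominator by e^-t, so that only the vanishing exponential remains. *)
have -> : (fun t => (q + expR t + expR (- t))^-1 *:
      (expR t *: xi + expR (- t) *: eta)) =
    (fun t => (q * expR (- t) + 1 + expR (- t) * expR (- t))^-1 *:
      (xi + (expR (- t) * expR (- t)) *: eta)).
  apply/funext => t; set E := expR (- t).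
  have -> : expR t = E^-1 by rewrite /E expRN invrK.
  have E0 : E != 0 by rewrite gt_eqF// expR_gt0.
  have -> : q * E + 1 + E * E = (q + E^-1 + E) * E by field.
  by rewrite invfM -[RHS]scalerA [in RHS]scalerDr (scalerA E^-1) mulKf.
suff : (q * expR (- t) + 1 + expR (- t) * expR (- t))^-1 *:
      (xi + (expR (- t) * expR (- t)) *: eta) @[t --> +oo]
    --> (q * 0 + 1 + 0 * 0)^-1 *: (xi + (0 * 0) *: eta).
  by rewrite !mulr0 add0r addr0 invr1 scale1r scale0r addr0.
have ee : expR (- t) * expR (- t) @[t --> +oo] --> (0 * 0 : R).
  by apply: cvgM; exact: e0.
apply: cvgZ.
  apply: cvgV; first by rewrite !mulr0 add0r addr0 oner_eq0.
  have c1 : q * expR (- t) @[t --> +oo] --> q * 0.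
    by apply: cvgM e0; exact: cvg_cst.
  exact: cvgD (cvgD c1 (cvg_cst (1 : R))) ee.
exact: cvgD (cvg_cst xi) (cvgZr_tmp ee).
Qed.

(* In Minkowski space the geodesic from eta to xi is the hyperbola
   (e^t (1, xi) + e^-t (1, eta)) / q, with q normalizing it to unit length. *)
Lemma boundary_geodesic xi eta : hboundary xi -> hboundary eta -> xi <> eta ->
  exists g, [/\ geodesic_on setT g, g t @[t --> -oo] --> eta &
                g t @[t --> +oo] --> xi].
Proof.
rewrite !hboundaryE => xi1 eta1 xe.
have k0 : 0 < 1 - dot xi eta.
  have := dot_ge0 (xi - eta); rewrite le_eqVlt => /predU1P[/esym /dot_eq0|].
    by move/eqP; rewrite subr_eq0 => /eqP.
  rewrite !dotE (dotC eta xi) xi1 eta1; lra.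
pose q := Num.sqrt (2 * (1 - dot xi eta)).
have q0 : 0 < q by rewrite sqrtr_gt0 mulr_gt0.
have q2 : q ^+ 2 = 2 * (1 - dot xi eta) by rewrite sqr_sqrtr// mulr_ge0// ltW.
(* A hyperboloid vector (p, u) projects to the ball point u / (1 + p); applied to the hyperbola,
   with [q] cleared, this gives [g]. *)
pose g t := (q + expR t + expR (- t))^-1 *: (expR t *: xi + expR (- t) *: eta).
have N0 t : 0 < q + expR t + expR (- t) by rewrite !addr_gt0 ?expR_gt0.
have dg t : dot (g t) (g t) = 1 - 2 * q / (q + expR t + expR (- t)).
  rewrite /g !dotE (dotC eta xi) xi1 eta1.
  have EE : expR t * expR (- t) = 1 by rewrite -expRD subrr expR0.
  have := N0 t; set E := expR t in EE *; set E' := expR (- t) in EE * => NE.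
  set N := q + E + E' in NE *.
  transitivity (N^-1 * (N^-1 * (N * (N - 2 * q)))).
    by set v := N^-1; rewrite /N; ring: EE q2.
  by rewrite mulKf ?gt_eqF// mulrBr mulVf ?gt_eqF//; ring.
have hg t : hspace (g t).
  by rewrite hspaceE dg ltrBlDr ltrDl divr_gt0 ?mulr_gt0.
exists g; split; last exact: cvg_boundary_geodesic.
- split=> [t _|s t _ _]; first exact: hg.
  rewrite hdistE -coshK; congr arcosh.
  rewrite cosh_dist_minkowski// /gap !dg.
  have Ns := N0 s; have Nt := N0 t.
  have e1 (a : R) : 1 - (1 - a) = a by ring.
  have e2 a : 2 / (2 * q / (q + expR a + expR (- a))) *: g a =
      q^-1 *: (expR a *: xi + expR (- a) *: eta).
    rewrite /g scalerA; congr (_ *: _); have := N0 a => Na.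
    by field; rewrite !gt_eqF.
  have e3 a : (1 + (1 - 2 * q / (q + expR a + expR (- a)))) /
      (2 * q / (q + expR a + expR (- a))) = (expR a + expR (- a)) / q.
    have := N0 a; set A := expR a; set A' := expR (- a) => Na.
    by field; rewrite !gt_eqF.
  rewrite !e1 !e2 !e3 !dotE (dotC eta xi) xi1 eta1.
  have -> : dot xi eta = 1 - q ^+ 2 / 2 by rewrite q2; field.
  rewrite /cosh (opprB s t) (addrC t) !expRD.
  set a := expR s; set a' := expR (- s); set b := expR t; set b' := expR (- t).
  by field; rewrite gt_eqF.
- apply/cvgNy_compNP.
  have -> : g \o -%R = fun t =>
      (q + expR t + expR (- t))^-1 *: (expR t *: eta + expR (- t) *: xi).
    by apply/funext => t; rewrite /g /= opprK addrAC [X in _ *: X]addrC.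
  exact: cvg_boundary_geodesic.
Qed.

Lemma convex_hull_nonempty L : L `<=` hboundary -> ~ is_subset1 L ->
  convex_hull L !=set0.
Proof.
move=> Lb; apply: contra_notP => /set0P/negP; rewrite negbK => /eqP h0.
move=> x y Lx Ly; apply: contrapT => xy.
have [g [gg gN gP]] := boundary_geodesic (Lb _ Lx) (Lb _ Ly) xy.
suff : convex_hull L (g 0) by rewrite h0.
apply: sub_gen_smallest; exists g; last by exists 0.
by split=> //; exists y => //; exists x.
Qed.

End convex_hull.

(** * Finite counts and exponential series *)

Section counting.
Context {R : realType} {T : choiceType}.
Implicit Types (X A : set T) (s : seq T) (f : T -> R).

Lemma enum_of_bounded_size A (N : R) :
  (forall s, uniq s -> (forall x, x \in s -> A x) -> (size s)%:R <= N) ->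
  exists s, uniq s /\ forall x, x \in s <-> A x.
Proof.
move=> h; have [/finite_seqP[s ->]|] := pselect (finite_set A).
  by exists (undup s); split=> [|x]; rewrite ?undup_uniq//= mem_undup.
have N0 : 0 <= N by apply: (h [::]).
move=> /(@infinite_set_fset _ _ (Num.truncn N).+1) [B BA NB].
have := h _ (finmap.fset_uniq B) (fun x xB => BA x xB).
have /andP[_] := truncn_itv N0; move: NB; rewrite -(ler_nat R); lra.
Qed.

Lemma sum_le_esum X f s (S : R) : (forall x, 0 <= f x) ->
  (\esum_(x in X) (f x)%:E <= S%:E)%E -> uniq s -> (forall x, x \in s -> X x) ->
  \sum_(x <- s) f x <= S.
Proof.
move=> f0 fS us sX; rewrite -lee_fin -sumEFin; apply: le_trans fS.
apply: esum_ge; exists [set` s]; first by split => //; exact: finite_seq.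
by rewrite fsbig_seq.
Qed.

Lemma esum_le X f (S : R) :
  (forall s, uniq s -> (forall x, x \in s -> X x) -> \sum_(x <- s) f x <= S) ->
  (\esum_(x in X) (f x)%:E <= S%:E)%E.
Proof.
move=> h; apply: ge_ereal_sup => _ [A [finA AX] <-].
rewrite fsbig_finite//= sumEFin lee_fin; apply: h => [|x].
  exact: finmap.fset_uniq.
by rewrite in_fset_set// => /set_mem /AX.
Qed.

(** Group points by the integer part k of [f]: at most C e^(a (k+1)) of them contribute at most
    e^(-bk) each, which is dominated by a geometric series of ratio e^(-(b-a)). *)
Lemma esum_expR_lt_pinfty X f (a b C : R) : 0 <= a -> a < b ->
  (forall x, X x -> 0 <= f x) ->
  (forall s (r : R), 0 <= r -> uniq s -> (forall x, x \in s -> X x) ->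
     (forall x, x \in s -> f x <= r) -> (size s)%:R <= C * expR (a * r)) ->
  (\esum_(x in X) (expR (- b * f x))%:E < +oo)%E.
Proof.
move=> a0 ab f0 cnt.
have C0 : 0 <= C.
  by have := cnt [::] 0; rewrite mulr0 expR0 mulr1; apply.
pose q := expR (- (b - a)).
have q0 : 0 < q := expR_gt0 _.
have q1 : q < 1 by rewrite -expR0 ltr_expR oppr_lt0 subr_gt0.
apply: (@le_lt_trans _ _ (C * expR a / (1 - q))%:E); last exact: ltry.
apply: esum_le => s us sX.
pose K := (\max_(x <- s) Num.truncn (f x)).+1.
(* The summand at k = truncn (f x) alone suffices. The indicator is that of f x <= k + 1 instead of
   the shell, so that the counting hypothesis applies to it directly. *)
have term x : x \in s -> expR (- b * f x) <=
    \sum_(k < K) (f x <= k.+1%:R)%R%:R * expR (- b * k%:R).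
  move=> xs; have /andP[k1 k2] := truncn_itv (f0 _ (sX _ xs)).
  have kK : (Num.truncn (f x) < K)%N.
    rewrite /K ltnS.
    exact: (@leq_bigmax_seq _ _ xpredT (fun x => Num.truncn (f x)) x).
  rewrite (bigD1 (Ordinal kK))//= (ltW k2) mul1r -[leLHS]addr0 lerD//.
    by rewrite ler_expR !mulNr lerN2 ler_wpM2l//; lra.
  by apply: sumr_ge0 => i _; rewrite mulr_ge0// expR_ge0.
apply: (@le_trans _ _ (\sum_(x <- s) \sum_(k < K)
    (f x <= k.+1%:R)%R%:R * expR (- b * k%:R))).
  by rewrite big_seq [leRHS]big_seq ler_sum.
rewrite exchange_big /=.
apply: (@le_trans _ _ (\sum_(k < K) C * expR a * q ^+ k)); last first.
  rewrite -(big_mkord xpredT (fun k => C * expR a * q ^+ k)).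
  apply: geometric_le_lim => //; first by rewrite mulr_ge0// expR_ge0.
  by rewrite ger0_norm// ltW.
apply: ler_sum => k _; rewrite -mulr_suml.
have -> : \sum_(x <- s) (f x <= k.+1%:R)%R%:R =
    (size [seq x <- s | (f x <= k.+1%:R)%R])%:R :> R.
  rewrite size_filter -sum1_count natr_sum [RHS]big_mkcond /=.
  by apply: eq_bigr => x _; case: ifP.
apply: (@le_trans _ _ (C * expR (a * k.+1%:R) * expR (- b * k%:R))).
  rewrite ler_wpM2r ?expR_ge0// cnt ?filter_uniq//.
    by move=> x; rewrite mem_filter => /andP[_ /sX].
  by move=> x; rewrite mem_filter => /andP[].
rewrite /q -expRM_natl -!mulrA -!expRD ler_wpM2l// ler_expR -natr1; lra.
Qed.

End counting.

(** * Entropy against critical exponent *)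

Section entropy.
Context {R : realType} {m : nat}.
Local Notation V := 'rV[R]_m.
Implicit Types (x y z w : V) (L X : set V) (s : seq V).

Lemma le_lne (v : \bar R) (b : R) : 0 < b -> (v <= b%:E)%E ->
  (lne v <= (ln b)%:E)%E.
Proof.
move=> b0; case: v => [r| |] //=; rewrite ?leNye//.
rewrite lee_fin => rb; case: ifPn; rewrite ?leNye// -ltNge => r0.
by rewrite lee_fin ler_ln ?posrE.
Qed.

Lemma uniformly_distributed_sub L X : uniformly_distributed L X ->
  forall x, X x -> hspace x.
Proof. by case=> XH _ _ _ x /XH; exact: convex_hull_sub_hspace. Qed.

Lemma hvol_le_count L X z (e : R) : uniformly_distributed L X -> hspace z ->
  0 < e -> exists2 K : R, 0 <= K & exists2 C : R, 0 < C & forall (r : R) s,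
    (forall x, X x -> hdist x z <= r + K -> x \in s) ->
    (forall x, x \in s -> X x) ->
  (hvol (hball z r `&` hneighborhood e (convex_hull L)) <=
   ((size s)%:R * C)%:E)%E.
Proof.
move=> XU hz e0; have hX := uniformly_distributed_sub XU.
case: XU => _ _ [M dense] _.
(* The sign of [M] is not given, hence the absolute value. *)
exists (`|M| + e); first by rewrite addr_ge0// ltW.
exists ((2 * cosh (`|M| + e) * (4 * cosh (`|M| + e))) ^+ m).
  have := cosh_ge1 (`|M| + e); move: (cosh _) => k k1.
  have k0 : 0 < k by lra.
  by rewrite exprn_gt0// !mulr_gt0.
move=> r s sX Xs; apply: hvol_le_covering.
- by rewrite addr_ge0// ltW.
- by move=> y [[]].
- by move=> x /Xs /hX.
move=> y [[hy zy] [_ [p Hp yp]]].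
have hp := convex_hull_sub_hspace Hp; have [x Xx px] := dense _ Hp.
have hx := hX _ Xx; have MM := ler_norm M.
have xy : hdist x y <= `|M| + e.
  have := hdist_triangle hx hp hy; rewrite (hdistC p y); lra.
exists x => //; apply: sX => //.
have := hdist_triangle hx hy hz; rewrite (hdistC y z); lra.
Qed.

Lemma count_le_hvol L X z (e : R) : uniformly_distributed L X -> hspace z ->
  0 < e -> exists2 K : R, 0 <= K & exists2 c : R, 0 < c & forall (r : R) s,
    uniq s -> (forall x, x \in s -> X x) ->
    (forall x, x \in s -> hdist x z + K < r) ->
  (((size s)%:R * c)%:E <=
    hvol (hball z r `&` hneighborhood e (convex_hull L)))%E.
Proof.
move=> XU hz e0; have hX := uniformly_distributed_sub XU.
case: XU => XH _ _ [d d0 sep].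
(* Balls of radius [K] about [X] are disjoint because 2 K < d, and stay in the neighbourhood because
   K < e. *)
pose K := Num.min (d / 4) (e / 2).
have K0 : 0 < K by rewrite lt_min !divr_gt0.
have [Kd Ke] : K <= d / 4 /\ K <= e / 2.
  by split; rewrite ge_min lexx ?orbT.
exists K; first exact: ltW.
have [c c0 hc] := @hvol_ge_packing R m K K0.
exists c => // r s us sX sr; apply: hc => //.
- by move=> x /sX /hX.
- by move=> y [[]].
- move=> x y /sX Xx /sX Xy xy; have := sep _ _ Xx Xy (elimN eqP xy); lra.
move=> x y xs hy xy; have hx := hX _ (sX _ xs).
split; split => //.
  have := hdist_triangle hz hx hy; have := sr _ xs.
  by rewrite (hdistC z x); lra.
by exists x; [exact: XH (sX _ xs)|rewrite hdistC; lra].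
Qed.

Let entropy L z (e : R) : \bar R := limf_esup (fun r : R =>
    (lne (hvol (hball z r `&` hneighborhood e (convex_hull L)))
       * (r^-1)%:E)%E) (pinfty_nbhs R).

(** Every counted point contributes at least e^(-a (r + K + D)) to the convergent series, so the
    count, and with it the volume, is at most a constant times e^(ar). The distance [D] absorbs the
    change of reference point. *)
Lemma entropy_le L X z w (e a : R) : uniformly_distributed L X ->
  hspace z -> hspace w -> 0 < e -> 0 < a ->
  (\esum_(x in X) (expR (- a * hdist x w))%:E < +oo)%E ->
  (entropy L z e <= a%:E)%E.
Proof.
move=> XU hz hw e0 a0 sumfin; have hX := uniformly_distributed_sub XU.
have [K K0 [C C0 upper]] := hvol_le_count XU hz e0.
have sum0 : (0 <= \esum_(x in X) (expR (- a * hdist x w))%:E)%E.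
  by apply: esum_ge0 => x _; rewrite lee_fin expR_ge0.
pose S := fine (\esum_(x in X) (expR (- a * hdist x w))%:E).
have sumS : (\esum_(x in X) (expR (- a * hdist x w))%:E = S%:E)%E.
  by rewrite fineK// ge0_fin_numE.
have S0 : 0 <= S by exact: fine_ge0.
pose D := hdist z w.
have count (r : R) s : uniq s ->
    (forall x, x \in s -> X x /\ hdist x z <= r + K) ->
    (size s)%:R <= S * expR (a * (r + K + D)).
  move=> us sX; rewrite -ler_pdivrMr ?expR_gt0//.
  rewrite -expRN.
  apply: le_trans (_ : \sum_(x <- s) expR (- a * hdist x w) <= S).
    rewrite -sum1_size natr_sum mulr_suml big_seq [leRHS]big_seq.
    apply: ler_sum => x /sX[/hX hx xz].
    rewrite mul1r ler_expR !mulNr lerN2 ler_wpM2l ?(ltW a0)//.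
    by have := hdist_triangle hx hz hw; rewrite -/D; lra.
  apply: (@sum_le_esum _ _ X) us _ => [x||x /sX[]//]; first exact: expR_ge0.
  by rewrite sumS.
(* The added 1 makes ln B nonnegative, so that r > ln B / eta implies r > 0. *)
pose B := S * expR (a * (K + D)) * C + 1.
have B1 : 1 <= B.
  by rewrite lerDr mulr_ge0 ?(ltW C0)// mulr_ge0// expR_ge0.
have vol (r : R) : 0 < r ->
    (hvol (hball z r `&` hneighborhood e (convex_hull L)) <=
     (B * expR (a * r))%:E)%E.
  move=> r0.
  have [s [us sE]] := @enum_of_bounded_size R _
    [set x | X x /\ hdist x z <= r + K] (S * expR (a * (r + K + D)))
    (fun s us sX => count r s us sX).
  apply: (le_trans (upper r s _ _)) => [x Xx xr|x /sE[]//|].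
    by apply/sE.
  rewrite lee_fin.
  have /(ler_wpM2r (ltW C0)) := count r s us (fun x xs => (sE x).1 xs).
  move=> /le_trans; apply.
  have -> : a * (r + K + D) = a * (K + D) + a * r by ring.
  rewrite expRD /B mulrDl mul1r.
  have := expR_ge0 (a * r); lra.
apply/lee_addgt0Pr => eta eta0.
have lnB : 0 <= ln B by rewrite ln_ge0.
rewrite /entropy /limf_esup; apply: le_trans.
  (* On this tail the error term ln B / r is below [eta]. *)
  apply: ereal_inf_lbound; exists [set r : R | ln B / eta < r] => //.
  by apply: nbhs_pinfty_gt; exact: num_real.
apply: ge_ereal_sup => _ [r /= Br <-].
have r0 : 0 < r by apply: le_lt_trans Br; rewrite divr_ge0// ltW.
have := le_lne _ (vol r r0); rewrite mulr_gt0 ?expR_gt0//; last by lra.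
move=> /(_ isT) h.
apply: (@le_trans _ _ ((ln (B * expR (a * r)))%:E * (r^-1)%:E)%E).
  by apply: lee_wpmul2r => //; rewrite lee_fin invr_ge0 ltW.
rewrite -EFinM -EFinD lee_fin lnM ?posrE ?expR_gt0//; last by lra.
rewrite expRK ler_pdivrMr// mulrDl addrC lerD2l.
by rewrite mulrC -ler_pdivrMr// ltW.
Qed.

(** Past some radius the volume is at most e^(ar), and [count_le_hvol] turns this into a bound on
    the count. A single point of [X] keeps the volume away from 0, which excludes a < 0. *)
Lemma count_le_of_entropy_lt L X z w (e a : R) : uniformly_distributed L X ->
  X !=set0 -> hspace z -> hspace w -> 0 < e -> (entropy L z e < a%:E)%E ->
  0 <= a /\ exists C : R, forall s (r : R), 0 <= r -> uniq s ->
    (forall x, x \in s -> X x) -> (forall x, x \in s -> hdist x w <= r) ->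
    (size s)%:R <= C * expR (a * r).
Proof.
move=> XU [x0 Xx0] hz hw e0; have hX := uniformly_distributed_sub XU.
have [K K0 [c c0 lower]] := count_le_hvol XU hz e0.
rewrite /entropy /limf_esup => /ereal_inf_lt[_ [U [r0 [_ r0U]] <-] supU].
have vol (r : R) : 0 < r -> r0 < r ->
    (hvol (hball z r `&` hneighborhood e (convex_hull L)) <=
     (expR (a * r))%:E)%E.
  move=> rpos /r0U Ur; set v := hvol _.
  have : (lne v * (r^-1)%:E < a%:E)%E.
    by apply: le_lt_trans supU; apply: ereal_sup_ubound; exists r.
  case: v => [v| |]; last by rewrite leNye.
    rewrite /=; case: ifPn => [v0 _|].
      by rewrite lee_fin (le_trans v0)// expR_ge0.
    rewrite -ltNge -EFinM lte_fin ltr_pdivrMr// lee_fin => v0 va.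
    by rewrite -[v]lnK ?posrE// ler_expR ltW.
  by rewrite /= mulyr sgrV gtr0_sg// mul1e.
have size_le (r : R) s : 0 < r -> r0 < r -> uniq s ->
    (forall x, x \in s -> X x) -> (forall x, x \in s -> hdist x z + K < r) ->
    (size s)%:R * c <= expR (a * r).
  move=> rpos rr us sX sr; rewrite -lee_fin.
  exact: le_trans (lower r s us sX sr) (vol r rpos rr).
split.
  rewrite leNgt; apply/negP => aneg.
  (* Large enough for the volume bound and for the ball about [x0]; also r > ln c / a, so e^(ar) < c
     as [a] is negative. *)
  pose r := `|r0| + `|ln c / a| + hdist x0 z + K + 1.
  have d0 := hdist_ge0 (hX _ Xx0) hz.
  have := ler_norm r0; have := ler_norm (ln c / a).
  have := normr_ge0 r0; have := normr_ge0 (ln c / a) => n1 n2 n3 n4.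
  have := size_le r [:: x0]; rewrite /= mul1r => /(_ _ _ isT) h.
  have : c <= expR (a * r).
    apply: h; rewrite /r; first by lra.
    - by lra.
    - by move=> x; rewrite inE => /eqP->.
    - by move=> x; rewrite inE => /eqP->; lra.
  rewrite -[c]lnK ?posrE// ler_expR leNgt => /negP; apply.
  by rewrite mulrC -ltr_ndivrMr// /r; lra.
pose D := hdist w z; have D0 : 0 <= D := hdist_ge0 hw hz.
(* The volume bound is used at radius r + |r0| + D + K + 1, which exceeds r0 and leaves room [K]
   around the points after moving from [w] to [z]. *)
exists (expR (a * (`|r0| + D + K + 1)) / c) => s r rpos us sX sr.
have := ler_norm r0; have := normr_ge0 r0 => n1 n2.
rewrite mulrAC ler_pdivlMr// -expRD -mulrDr.
apply: size_le => //; [lra|lra|move=> x xs].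
have := hdist_triangle (hX _ (sX _ xs)) hw hz; have := sr _ xs.
by rewrite -/D; lra.
Qed.

Lemma critical_exponent_le L X z w (e : R) : uniformly_distributed L X ->
  X !=set0 -> hspace z -> hspace w -> 0 < e ->
  (critical_exponent X w <= entropy L z e)%E.
Proof.
move=> XU X0 hz hw e0; have hX := uniformly_distributed_sub XU.
have key (a b : R) : (entropy L z e < a%:E)%E -> a < b ->
    (critical_exponent X w <= b%:E)%E.
  move=> ha ab.
  have [a0 [C hC]] := count_le_of_entropy_lt XU X0 hz hw e0 ha.
  apply: ereal_inf_lbound; exists b => //; split; first exact: le_lt_trans ab.
  by apply: esum_expR_lt_pinfty a0 ab _ hC => x /hX hx; exact: hdist_ge0.
case E : (entropy L z e) => [h| |]; last 2 first.
- by rewrite leey.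
(* Entropy -oo would make -1 an admissible growth rate, but such rates are nonnegative. *)
- have ha : (entropy L z e < (-1)%:E)%E by rewrite E ltNyr.
  by have [+ _] := count_le_of_entropy_lt XU X0 hz hw e0 ha; rewrite ler0N1.
apply/lee_addgt0Pr => eta eta0; rewrite -EFinD.
apply: (key (h + eta / 2)); last by lra.
by rewrite E lte_fin ltrDl divr_gt0.
Qed.

Lemma critical_exponent_ge0 X w : (0 <= critical_exponent X w)%E.
Proof. by apply: le_ereal_inf_tmp => _ [a [a0 _] <-]; rewrite lee_fin ltW. Qed.

Lemma critical_exponent_set0 w : critical_exponent set0 w = 0%E.
Proof.
apply/eqP; rewrite eq_le critical_exponent_ge0 andbT.
apply/lee_addgt0Pr => a a0; rewrite add0e; apply: ereal_inf_lbound.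
by exists a => //; split => //; rewrite esum_set0 ltry.
Qed.

End entropy.

Theorem proposition3p4 (R : realType) (n : nat) (n_gt0 : (0 < n)%N)
    (L : set 'rV[R]_n.+1) (L_closed : closed L) (L_bd : L `<=` hboundary)
    (X : set 'rV[R]_n.+1) (X_unif : uniformly_distributed L X)
    (z w : 'rV[R]_n.+1) (z_in : hspace z) (w_in : hspace w)
    (e : R) (e_gt0 : 0 < e) :
  convex_core_entropy L z e = critical_exponent X w.
Proof.
(* With at most one limit point the hull and [X] are empty and both sides are 0; otherwise density
   in the nonempty hull provides a point of [X]. *)
rewrite /convex_core_entropy; case: asboolP => [L1|L2].
  have -> : X = set0.
    case: X_unif => XH _ _ _; apply/seteqP; split => //.
    by rewrite -(convex_hull_subset1 L1).
  by rewrite critical_exponent_set0.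
have X0 : X !=set0.
  have [p Hp] := convex_hull_nonempty L_bd L2.
  by case: X_unif => _ _ [M dense] _; have [x Xx _] := dense _ Hp; exists x.
apply/eqP; rewrite eq_le; apply/andP; split.
  apply: le_ereal_inf_tmp => _ [a [a0 afin] <-].
  exact: entropy_le X_unif _ _ _ _ afin.
exact: critical_exponent_le X_unif X0 z_in w_in e_gt0.
Qed.
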